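(* Let $\mathcal U$ and $\mathcal V$ be ultrafilters on $\mathbb N$. Then $\mathcal U\leq_{\mathrm{fe}}\mathcal V$ if and only if $\mathcal V$ is in the closure, in $\beta\mathbb N$, of the set of sums $\{\mathcal U+\mathcal W:\mathcal W\in\beta\mathbb N\}$.
   Context: $\mathbb N$ contains $0$. For $A\subseteq\mathbb N$ and $k\in\mathbb N$: $A+k=\{a+k:a\in A\}$ and $A-k=\{x\in\mathbb N:x+k\in A\}$. For $A,B\subseteq\mathbb N$, $A\leq_{\mathrm{fe}}B$ means that for each finite $F\subseteq A$ there is $k\in\mathbb N$ with $F+k\subseteq B$. For ultrafilters $\mathcal U,\mathcal V$ on $\mathbb N$, $\mathcal U\leq_{\mathrm{fe}}\mathcal V$ means that for each $B\in\mathcal V$ there is some $A\in\mathcal U$ with $A\leq_{\mathrm{fe}}B$. $\beta\mathbb N$ is the space of all ultrafilters on $\mathbb N$ (principal ones included), with basic open sets $\overline A=\{\mathcal U\in\beta\mathbb N:A\in\mathcal U\}$ for $A\subseteq\mathbb N$. Addition on $\beta\mathbb N$ is $\mathcal U+\mathcal V=\{X\subseteq\mathbb N:\{k\in\mathbb N:X-k\in\mathcal V\}\in\mathcal U\}$. *)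

(* Defs.v *)
From HB Require Import structures.
From mathcomp Require Import all_boot.
From mathcomp Require Import all_classical.
From mathcomp Require Import topology_structure.

Set Implicit Arguments.
Unset Strict Implicit.
Unset Printing Implicit Defensive.

Local Open Scope classical_set_scope.

Definition shift_up (A : set nat) (k : nat) : set nat :=
  [set (a + k)%N | a in A].

Definition shift_down (A : set nat) (k : nat) : set nat :=
  [set x | A (x + k)%N].

Definition set_fe (A B : set nat) : Prop :=
  forall F : set nat, finite_set F -> F `<=` A ->
    exists k : nat, shift_up F k `<=` B.

(* The underlying family is a coercion, so U A says that A belongs to U. *)
Record betaN := BetaN {
  betaN_sets :> set nat -> Prop ;
  betaN_ultra : UltraFilter betaN_sets
}.

#[export] Existing Instance betaN_ultra.

HB.instance Definition _ := gen_eqMixin betaN.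
HB.instance Definition _ := gen_choiceMixin betaN.

Definition basic_open (A : set nat) : set betaN := [set U : betaN | U A].

Lemma basic_open_cover :
  \bigcup_(A in [set: set nat]) basic_open A = [set: betaN].
Proof.
by apply/seteqP; split=> // U _; exists setT => //; exact: filterT.
Qed.

Lemma basic_open_join (A B : set nat) (U : betaN) :
  setT A -> setT B -> basic_open A U -> basic_open B U ->
  exists C, [/\ setT C, basic_open C U &
                basic_open C `<=` basic_open A `&` basic_open B].
Proof.
move=> _ _ UA UB; exists (A `&` B); split=> //; first exact: filterI.
by move=> W WAB; split; apply: filterS WAB => x [].
Qed.

HB.instance Definition _ :=
  isBaseTopological.Build betaN basic_open_cover basic_open_join.

Definition ultra_fe (U V : betaN) : Prop :=
  forall B : set nat, V B -> exists2 A : set nat, U A & set_fe A B.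

(* The outer quantifier is over the first summand. *)
Definition sum_sets (U V : betaN) : set_system nat :=
  [set X | U [set k | V (shift_down X k)]].

Lemma sum_sets_ultra (U V : betaN) : UltraFilter (sum_sets U V).
Proof.
have filtU (W : betaN) : Filter (betaN_sets W) by exact: filter_filter.
have sumF : ProperFilter (sum_sets U V).
  split.
    rewrite /sum_sets /= => U0; apply: (filter_not_empty (betaN_sets U)).
    by apply: (filterS _ U0) => k /(filter_not_empty (betaN_sets V)).
  split.
  - rewrite /sum_sets /=; apply: (filterS _ (@filterT _ _ (filtU U))) => k _.
    exact: filterT.
  - move=> A B; rewrite /sum_sets /= => UA UB.
    apply: (filterS _ (filterI UA UB)) => k [VA VB].
    exact: (filterI VA VB).
  - move=> A B AB; rewrite /sum_sets /=; apply: filterS => k /=.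
    by apply: filterS => x; exact: AB.
split=> // G GF sG; apply/seteqP; split=> // X GX.
have [//|nUX] := in_ultra_setVsetC [set k | V (shift_down X k)] (betaN_ultra U).
exfalso; apply: (filter_not_empty G).
rewrite -(setICr X); apply: filterI => //; apply: sG.
rewrite /sum_sets /=; apply: (filterS _ nUX) => k nVX.
by have [/nVX|] := in_ultra_setVsetC (shift_down X k) (betaN_ultra V).
Qed.

Definition betaN_add (U V : betaN) : betaN := BetaN (sum_sets_ultra U V).

(* Main.v *)
(* [A <=fe B] says exactly that the shifts [B - a], [a \in A], have the finite
   intersection property, i.e. that some ultrafilter [W] contains all of them;
   so some member of [U] is finitely embeddable in [B] iff [B] belongs to
   [U + W] for some [W]. As [B] ranges over [V], this says that every basic
   neighbourhood of [V] meets the set of sums. *)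
Require Import Defs.
From mathcomp Require Import all_boot.
From mathcomp Require Import finmap.
From mathcomp Require Import all_classical.
From mathcomp Require Import topology_structure.

Local Open Scope classical_set_scope.

(** A point [k] common to the sets [shift_down B a], for [a] in [F], is exactly a shift that carries
    [F] into [B]. *)
Lemma set_feP (A B : set nat) : set_fe A B <-> finI A (shift_down B).
Proof.
split=> [feAB F FA | finAB F /finite_fsetP[D ->] DA].
  have [|k kB] := feAB [set` F] (finite_fset F).
    by move=> a /FA; rewrite inE.
  by exists k => a Fa; apply: kB; exists a => //; rewrite addnC.
have [|k kB] := finAB D; first by move=> a Da; rewrite inE; exact: DA.
by exists k => _ [a Da <-]; rewrite addnC; exact: kB.
Qed.

Lemma set_fe_ultra (A B : set nat) :
  set_fe A B <-> exists W : betaN, A `<=` [set k | W (shift_down B k)].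
Proof.
rewrite set_feP; split=> [finAB | [W AW] F FA]; last first.
  (* A finite intersection of members of [W] lies in [W], hence is nonempty. *)
  apply: (@filter_ex _ W); apply: filter_bigI => a /FA.
  by rewrite inE => /AW.
have [W [Wultra subW]] := ultraFilterLemma (finI_filter finAB).
exists (BetaN Wultra) => a Aa; apply: subW.
by exists (shift_down B a) => //; exact: finI_from1.
Qed.

Lemma ex_set_fe_sum (U : betaN) (B : set nat) :
  (exists2 A, U A & set_fe A B) <-> exists W, betaN_add U W B.
Proof.
split=> [[A UA /set_fe_ultra[W AW]] | [W UWB]].
  by exists W; exact: filterS UA.
(* The largest [A] that [W] can serve; [UWB] says that it is in [U]. *)
by exists [set k | W (shift_down B k)] => //; apply/set_fe_ultra; exists W.
Qed.

Lemma nbhs_betaN (V : betaN) (N : set betaN) :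
  nbhs V N <-> exists2 B, V B & basic_open B `<=` N.
Proof.
split=> [|[B VB BN]].
  (* An open set is a union of basic ones, indexed by [D]; one of them contains [V]. *)
  rewrite nbhsE => -[_ [[D _ <-] [B DB VB]] DN].
  by exists B => //; apply: subset_trans DN; exact: bigcup_sup.
rewrite nbhsE; exists (basic_open B) => //; split=> //.
by exists [set B] => //; rewrite bigcup_set1.
Qed.

Lemma closure_betaN (S : set betaN) (V : betaN) :
  closure S V <-> forall B, V B -> exists2 W, S W & W B.
Proof.
split=> [clSV B VB | SV N /nbhs_betaN[B /SV[W SW WB] BN]].
  have [|W [SW WB]] := clSV (basic_open B); last by exists W.
  by apply/nbhs_betaN; exists B.
by exists W; split=> //; exact: BN.
Qed.

Theorem theorem11 (U V : betaN) :
  ultra_fe U V <-> closure [set betaN_add U W | W in [set: betaN]] V.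
Proof.
rewrite closure_betaN; split=> feUV B /feUV.
  by move=> /ex_set_fe_sum[W UWB]; exists (betaN_add U W) => //; exists W.
by move=> [_ [W _ <-] UWB]; apply/ex_set_fe_sum; exists W.
Qed.
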